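(* Let $N, p \ge 1$ be integers, let $A \in \mathbb{R}^{N\times N}$, let $b_0, b_1, \ldots, b_p \in \mathbb{R}^N$, and let $\tau \in \mathbb{R}$. Let $B = [b_p, \ldots, b_2, b_1] \in \mathbb{R}^{N\times p}$ (the matrix whose columns, from left to right, are $b_p, b_{p-1}, \ldots, b_1$), let $K = \begin{bmatrix} 0 & I_{p-1} \\ 0 & 0 \end{bmatrix} \in \mathbb{R}^{p\times p}$, and let $v = [b_0^{\mathsf{T}}, e_p^{\mathsf{T}}]^{\mathsf{T}} \in \mathbb{R}^{N+p}$. Define the augmented matrix $$\tilde{A} = \begin{bmatrix} A & B \\ 0 & K \end{bmatrix} \in \mathbb{R}^{(N+p)\times(N+p)}$$ and let $w = e^{\tau\tilde{A}} v$. Then the first $N$ elements of the vector $w$ are given by $$w(1:N) = \sum_{j=0}^{p} \tau^j \varphi_j(\tau A)\, b_j,$$ and the rest of the vector is $$w(N+1:N+p) = \left[\frac{\tau^{p-1}}{(p-1)!}, \ldots, \tau, 1\right]^{\mathsf{T}},$$ that is, its $i$-th entry is $\tau^{p-i}/(p-i)!$ for $i = 1, \ldots, p$.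
   Context: For a square real matrix $M$, $\varphi_0(M) = e^{M}$ is the matrix exponential and, for integers $k \ge 1$, $$\varphi_k(M) = \int_0^1 e^{(1-\theta)M}\, \frac{\theta^{k-1}}{(k-1)!}\, d\theta .$$ $I_l$ denotes the $l\times l$ identity matrix, and $e_p = (0,\ldots,0,1)^{\mathsf{T}} \in \mathbb{R}^p$ is the last canonical basis vector of $\mathbb{R}^p$. The matrix $K$ is thus the $p \times p$ matrix with ones on the first superdiagonal and zeros elsewhere (the $1\times 1$ zero matrix if $p=1$). For a vector $w$, $w(a:b)$ denotes the subvector of entries with indices from $a$ to $b$. *)

(* Defs.v *)
From HB Require Import structures.
From mathcomp Require Import all_boot all_order all_algebra.
From mathcomp Require Import all_classical all_reals all_analysis.

Set Implicit Arguments.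
Unset Strict Implicit.
Unset Printing Implicit Defensive.

Import Order.TTheory GRing.Theory Num.Theory.
Import numFieldNormedType.Exports.

Local Open Scope classical_set_scope.
Local Open Scope ring_scope.

(* The limit is taken in the normed space 'M[R]_n. *)
Definition expmx (R : realType) (n : nat) (M : 'M[R]_n) : 'M[R]_n :=
  limn (series (fun k : nat => (k`!%:R)^-1 *: M ^+ k)).

(* Matrix-valued integrals are taken entrywise. *)
Definition phimx (R : realType) (n : nat) (k : nat) (M : 'M[R]_n) : 'M[R]_n :=
  if k is k'.+1 then
    \matrix_(i, j) \int[lebesgue_measure]_(theta in `[0%R, 1%R])
      ((theta ^+ k' / k'`!%:R) *: expmx ((1 - theta) *: M)) i j
  else expmx M.

(* Columns are numbered from 0, so column j of [b_p, ..., b_1] is b_(p - j). *)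
Definition Bmx (R : realType) (N p : nat) (b : 'I_p.+1 -> 'cV[R]_N) :
    'M[R]_(N, p) :=
  \matrix_(i, j) b (inord (p - j)) i 0.

Definition Kmx (R : realType) (p : nat) : 'M[R]_p :=
  \matrix_(i, j) (j == i.+1 :> nat)%:R.

Definition ep (R : realType) (p : nat) : 'cV[R]_p :=
  \col_i (i.+1 == p :> nat)%:R.

Definition augmx (R : realType) (N p : nat) (A : 'M[R]_N)
    (b : 'I_p.+1 -> 'cV[R]_N) : 'M[R]_(N + p) :=
  block_mx A (Bmx b) 0 (Kmx R p).

(* Main.v *)
Require Import Defs.
From HB Require Import structures.
From mathcomp Require Import all_boot all_order all_algebra.
From mathcomp Require Import all_classical all_reals all_analysis.
From mathcomp Require Import measurable_realfun ring zify.

Set Implicit Arguments.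
Unset Strict Implicit.
Unset Printing Implicit Defensive.

Import Order.TTheory GRing.Theory Num.Theory.
Import numFieldNormedType.Exports.

Local Open Scope classical_set_scope.
Local Open Scope ring_scope.

(** The exponential of the augmented matrix is compared with the right-hand
side power by power, so everything rests on two facts.

The phi-functions are shifted exponential series: phi_k(M) is the sum over m
of M^m / (m + k)! ([phimx_cvg]).  For k = 0 this is the definition of the
exponential.  For k >= 1 one integrates the exponential series entrywise; the
m-th term contributes the beta integral of theta^(k-1) (1 - theta)^m, equal to
(k-1)! m! / (m + k)!, and dominated convergence allows the interchange of sum
and integral on [0, 1] ([cvg_integral_power_series]), because the entries of
M^m are bounded by r^m, with r the sum of the absolute values of the entries
of M ([normr_exprmx_le]).

The powers of the augmented matrix act on v in closed form
([exprmx_augmx_mul]).  The block K moves the 1 of e_p up by one position at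
each step, and in that position the block B reads off the next vector b_j, to
which A is applied from then on.  Hence the top block of (tau Atilde)^m v is
the sum of the tau^j (tau A)^(m-j) b_j over j <= min(m, p), and its bottom
block has the single entry tau^m, in position p - m, or is zero if m >= p.

Dividing by m! and summing over m < n, the coefficient of tau^j b_j in the top
block is a partial sum, of length n - j, of the series of phi_j(tau A), and
the bottom block is stationary as soon as n >= p.  The theorem follows by
letting n tend to infinity. *)

(** * Convergence of matrices and of their entries *)

Lemma cvg_sumr (K : numFieldType) (V : normedModType K) (T I : Type)
    (F : set_system T) (r : seq I) (P : pred I) (f : I -> T -> V) (l : I -> V) :
  Filter F -> (forall i, P i -> f i @ F --> l i) ->
  (\sum_(i <- r | P i) f i x) @[x --> F] --> \sum_(i <- r | P i) l i.
Proof. by move=> FF fl; apply: cvg_big => //; exact: add_continuous. Qed.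

(** A matrix is a finite combination of the elementary matrices, with its
entries as coefficients. *)
Lemma cvg_entries (K : numFieldType) (m n : nat) (u : nat -> 'M[K]_(m, n))
    (L : 'M[K]_(m, n)) :
  (forall i j, (u k i j) @[k --> \oo] --> L i j) -> u @ \oo --> L.
Proof.
move=> uL; rewrite (matrix_sum_delta L).
rewrite (funext (fun k => matrix_sum_delta (u k)) : u = _).
do 2!(apply: cvg_sumr => ? _).
by apply: cvgZl; exact: uL.
Qed.

Lemma cvg_coord (K : numFieldType) (m n : nat) (u : nat -> 'M[K]_(m, n))
    (L : 'M[K]_(m, n)) i j :
  u @ \oo --> L -> (u k i j) @[k --> \oo] --> L i j.
Proof. exact: (continuous_cvg _ (@coord_continuous _ _ _ i j L)). Qed.

Lemma cvg_mulmxr (K : numFieldType) (m n q : nat) (u : nat -> 'M[K]_(m, n))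
    (L : 'M[K]_(m, n)) (B : 'M[K]_(n, q)) :
  u @ \oo --> L -> (u k *m B) @[k --> \oo] --> L *m B.
Proof.
move=> uL; apply: cvg_entries => i j; rewrite mxE.
under eq_fun do rewrite mxE.
apply: cvg_sumr => l _; apply: cvgMl.
exact: cvg_coord.
Qed.

(** * Integrating a power series against theta^k *)

Lemma cvgn_EFin (R : realFieldType) (u : nat -> R) (l : R) :
  u @ \oo --> l -> (u n)%:E @[n --> \oo] --> l%:E.
Proof. by move=> ul; apply: cvg_EFin => //; exact: nearW. Qed.

Lemma beta_integral (R : realType) (k m : nat) :
  (\int[lebesgue_measure]_(x in `[0%R, 1%R]) (XMonemX k m x)%:E)%E =
    ((k`! * m`!)%:R / (k + m).+1`!%:R : R)%:E.
Proof.
by rewrite -beta_fun_fact EFin_beta_fun integral_XMonemX_restrict setTI.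
Qed.

(** Term by term, this is the beta integral.  On [0, 1] the partial sums are
dominated by the constant sum of the |c m|, which justifies the interchange;
the series on the left converges absolutely since m! <= (m + k + 1)!. *)
Lemma cvg_integral_power_series (R : realType) (k : nat) (c : nat -> R)
    (s : R -> R) :
  cvgn (series (fun m => `|c m|)) ->
  (forall x, x \in `[0, 1]%R ->
    series (fun m => c m * (1 - x) ^+ m) @ \oo --> s x) ->
  series (fun m => c m * (m`!%:R / (m + k).+1`!%:R)) @ \oo -->
    \int[lebesgue_measure]_(x in `[0%R, 1%R]) (x ^+ k / k`!%:R * s x).
Proof.
move=> cabs cs.
set a := fun m => c m * (m`!%:R / (m + k).+1`!%:R).
have acvg : cvgn (series a).
  apply: normed_cvg; apply: (series_le_cvg _ _ _ cabs) => [m|//|m];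
    rewrite ?normr_ge0//.
  rewrite /= normrM ler_piMr// ger0_norm// ler_pdivrMr ?ltr0n ?fact_gt0// mul1r.
  by rewrite ler_nat leq_fact// -addnS leq_addr.
set f_ := fun n x => \sum_(0 <= m < n) (c m / k`!%:R) * XMonemX k m x.
have intf (m : nat) : lebesgue_measure.-integrable `[0%R, 1%R]
    (fun x : R => ((c m / k`!%:R) * XMonemX k m x)%:E).
  exact: (integrableZl _ (c m / k`!%:R) (integrable_XMonemX k m)).
have intE n : (\int[lebesgue_measure]_(x in `[0%R, 1%R]) (f_ n x)%:E)%E =
    (series a n)%:E.
  under eq_integral do rewrite -sumEFin.
  rewrite integral_sum// -sumEFin; apply: eq_bigr => m _.
  under eq_integral do rewrite EFinM.
  rewrite integralZl//; last exact: integrable_XMonemX.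
  rewrite beta_integral -EFinM /a natrM addnC; congr _%:E.
  by rewrite !mulrA divfK ?pnatr_eq0 -?lt0n ?fact_gt0.
have : (\int[lebesgue_measure]_(x in `[0%R, 1%R]) (f_ n x)%:E)%E
    @[n --> \oo] -->
    (\int[lebesgue_measure]_(x in `[0%R, 1%R]) (x ^+ k / k`!%:R * s x)%:E)%E.
  (* x ^+ k / k`! and (1 - x) ^+ m are at most 1, whence the constant bound *)
  apply: (@dominated_cvg _ _ _ _ _ _ _ _
    (cst (limn (series (fun m => `|c m|)))%:E)) => //.
  - move=> n; apply/measurable_EFinP.
    by apply: measurable_sum => m;
    exact: measurable_funM (measurable_cst _) (measurable_XMonemX _ _).
  - move=> x x01; apply: cvgn_EFin.
    rewrite (_ : f_ ^~ x = fun n => x ^+ k / k`!%:R *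
        series (fun m => c m * (1 - x) ^+ m) n).
      by apply: cvgMr; exact: cs.
    apply/funext => n; rewrite /f_ /series/= mulr_sumr; apply: eq_bigr => m _.
    by rewrite /XMonemX /unstable.onem; ring.
  - by apply: continuous_compact_integrable;
      [exact: segment_compact|move=> x; exact: cst_continuous].
  - move=> n x x01; rewrite lee_fin.
    apply: (@le_trans _ _ (series (fun m => `|c m|) n)); last first.
      apply: nondecreasing_cvgn_le => //; apply: nondecreasing_series => m _ _.
      exact: normr_ge0.
    apply: (le_trans (ler_norm_sum _ _ _)); apply: ler_sum => m _.
    rewrite !normrM -mulrA ler_piMr// mulr_ile1//.
      by rewrite ger0_norm ?invr_ge0// invf_le1 ?ltr0n ?ler1n ?fact_gt0.
    have x01' : (x : R) \in `[0, 1]%R := x01.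
    by rewrite -normrM -/(XMonemX k m x) ger0_norm ?XMonemX_ge0 ?XMonemX_le1.
under eq_cvg do rewrite intE.
(* The extended-real limit [h] is finite because [series a] converges, so
   taking [fine] in the real-valued integral loses nothing. *)
move=> h; rewrite /Rintegral.
have /(cvg_unique _ h) -> // : (series a n)%:E @[n --> \oo] --> (limn (series a))%:E.
exact: cvgn_EFin.
Qed.

(** * The phi-functions as shifted exponential series *)

Lemma exprZmx (R : comPzRingType) (n : nat) (a : R) (M : 'M[R]_n) (k : nat) :
  (a *: M) ^+ k = a ^+ k *: M ^+ k.
Proof.
elim: k => [|k IH]; first by rewrite !expr0 scale1r.
by rewrite !exprS IH -!mulmxE -scalemxAl -scalemxAr scalerA.
Qed.

(** The bound r is an upper bound for every row sum of absolute values, which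
is all that the induction uses. *)
Lemma normr_exprmx_le (R : realDomainType) (n : nat) (M : 'M[R]_n) (k : nat) i j :
  `|(M ^+ k) i j| <= (\sum_a \sum_b `|M a b|) ^+ k.
Proof.
set r := \sum_a _.
have r0 : 0 <= r by apply: sumr_ge0 => a _; exact: sumr_ge0.
elim: k i j => [|k IH] i j.
  by rewrite !expr0 mxE; case: eqP; rewrite ?normr1 ?normr0.
rewrite !exprS -mulmxE mxE (le_trans (ler_norm_sum _ _ _))//.
apply: (@le_trans _ _ (\sum_l `|M i l| * r ^+ k)).
  by apply: ler_sum => l _; rewrite normrM ler_wpM2l.
rewrite -mulr_suml ler_wpM2r ?exprn_ge0// /r [leRHS](bigD1 i)//= lerDl.
by apply: sumr_ge0 => a _; exact: sumr_ge0.
Qed.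

Lemma is_cvg_norm_exprmx_coeff (R : realType) (n : nat) (M : 'M[R]_n) i j :
  cvgn (series (fun m => `|(m`!%:R)^-1 * (M ^+ m) i j|)).
Proof.
apply: (series_le_cvg _ _ _
  (is_cvg_series_exp_coeff (\sum_a \sum_b `|M a b|))) => [m|m|m];
  rewrite ?normr_ge0//.
  by apply: exp_coeff_ge0; apply: sumr_ge0 => a _; exact: sumr_ge0.
by rewrite /exp_coeff/= normrM ger0_norm ?invr_ge0// mulrC ler_wpM2r ?invr_ge0
  ?normr_exprmx_le.
Qed.

Lemma series_scale_mxE (R : nzRingType) (m n : nat) (a : nat -> R)
    (B : nat -> 'M[R]_(m, n)) k i j :
  series (fun l => a l *: B l) k i j = series (fun l => a l * B l i j) k.
Proof. by rewrite /series/= summxE; apply: eq_bigr => l _; rewrite mxE. Qed.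

(** The exponential is defined as a limit, which carries information only once
the series is known to converge. *)
Lemma expmx_cvg (R : realType) (n : nat) (M : 'M[R]_n) :
  series (fun k => (k`!%:R)^-1 *: M ^+ k) @ \oo --> expmx M.
Proof.
suff : cvgn (series (fun k => (k`!%:R)^-1 *: M ^+ k)) by [].
apply/cvg_ex; exists (\matrix_(i, j)
  limn (series (fun m => (m`!%:R)^-1 * (M ^+ m) i j))).
apply: cvg_entries => i j; rewrite mxE.
under eq_cvg do rewrite series_scale_mxE.
by apply: normed_cvg; exact: is_cvg_norm_exprmx_coeff.
Qed.

Lemma expmx_entry_cvg (R : realType) (n : nat) (M : 'M[R]_n) i j :
  series (fun m => (m`!%:R)^-1 * (M ^+ m) i j) @ \oo --> expmx M i j.
Proof.
have := @cvg_coord _ _ _ _ _ i j (@expmx_cvg R n M).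
by under eq_cvg do rewrite series_scale_mxE.
Qed.

(** In each entry, apply [cvg_integral_power_series] with the coefficients of
the exponential of (1 - x) M, whose powers of 1 - x have been factored out. *)
Lemma phimx_cvg (R : realType) (n k : nat) (M : 'M[R]_n) :
  series (fun m => ((m + k)`!%:R)^-1 *: M ^+ m) @ \oo --> phimx k M.
Proof.
case: k => [|k]; first by under eq_fun do rewrite addn0; exact: expmx_cvg.
apply: cvg_entries => i j; rewrite [phimx _ _ _ _]mxE.
under eq_cvg do rewrite series_scale_mxE.
pose c m := (m`!%:R)^-1 * (M ^+ m) i j.
rewrite (_ : (fun _ => _) = fun m => c m * (m`!%:R / (m + k).+1`!%:R)); last first.
  by apply/funext => m; rewrite /c addnS mulrAC !mulrA mulVf ?mul1r//.
under eq_Rintegral do rewrite mxE.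
apply: cvg_integral_power_series; first exact: is_cvg_norm_exprmx_coeff.
move=> x _; rewrite (_ : (fun _ => _) =
  fun m => (m`!%:R)^-1 * (((1 - x) *: M) ^+ m) i j); first exact: expmx_entry_cvg.
by apply/funext => m; rewrite exprZmx mxE /c; ring.
Qed.

(** * Powers of the augmented matrix *)

(** The vector with its 1 in position p - m (counted from 1) selects the
column b_(m+1) of B; once the 1 has left the vector, that is for m >= p, the
product is zero, like the empty sum on the right. *)
Lemma mul_Bmx_shifted_ep (R : realType) (N p m : nat) (b : 'I_p.+1 -> 'cV[R]_N) :
  Bmx b *m (\col_i (i.+1 + m == p)%N%:R) = \sum_(j < p.+1 | j == m.+1 :> nat) b j.
Proof.
have [mp|pm] := ltnP m p; last first.
  rewrite big1 => [|j /eqP jm]; last by have := ltn_ord j; rewrite jm; lia.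
  apply/matrixP => i l; rewrite !mxE big1// => a _; rewrite !mxE.
  by rewrite (_ : _ == _ = false) ?mulr0//; have := ltn_ord a; lia.
have ltp : (p - m.+1 < p)%N by lia.
rewrite (big_pred1 (inord m.+1)) => [|j]; last first.
  by rewrite /= -val_eqE /= inordK.
apply/matrixP => i l; rewrite ord1 !mxE (bigD1 (Ordinal ltp))//= !mxE big1.
  rewrite addr0 (_ : _ == _ = true) ?mulr1 ?subKn//=.
  by rewrite -subSn// subSS; lia.
move=> a /negP aP; rewrite !mxE (_ : _ == _ = false) ?mulr0//.
by apply/negP => /eqP am; apply: aP; rewrite -val_eqE /=; lia.
Qed.

(** The 1 moves up by one row; it leaves through the first row when m = p - 1,
and both sides vanish from then on. *)
Lemma mul_Kmx_shifted_ep (R : realType) (p m : nat) :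
  Kmx R p *m (\col_i (i.+1 + m == p)%N%:R) =
    \col_(i < p) (i.+1 + m.+1 == p)%N%:R :> 'cV[R]_p.
Proof.
apply/matrixP => i l; rewrite !mxE.
have [ip|pi] := ltnP i.+1 p.
  rewrite (bigD1 (Ordinal ip))//= !mxE eqxx mul1r big1 => [|a aP].
    by rewrite addr0 -addSnnS.
  by rewrite !mxE [_ == i.+1](_ : _ = false) ?mul0r//; exact/negbTE.
rewrite big1 => [|a _].
  by rewrite (_ : _ == _ = false)//; have := ltn_ord i; lia.
by rewrite !mxE [_ == i.+1](_ : _ = false) ?mul0r//; have := ltn_ord a; lia.
Qed.

(** The top block is Duhamel's formula in discrete time: b_0 is present from
the start and b_j is injected at step j, after which each step multiplies it
by tau A. *)
Lemma exprmx_augmx_mul (R : realType) (N p : nat) (A : 'M[R]_N)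
    (b : 'I_p.+1 -> 'cV[R]_N) (tau : R) (m : nat) :
  (tau *: augmx A b) ^+ m *m col_mx (b ord0) (ep R p) =
  col_mx (\sum_(j < p.+1 | (j <= m)%N) tau ^+ j *: ((tau *: A) ^+ (m - j) *m b j))
         (tau ^+ m *: \col_(i < p) (i.+1 + m == p)%N%:R).
Proof.
elim: m => [|m IH].
  rewrite expr0 mul1mx scale1r (big_pred1 ord0) => [|j]; last first.
    by rewrite /= -val_eqE /= leqn0.
  rewrite !expr0 scale1r mul1mx; congr col_mx.
  by apply/matrixP => i l; rewrite !mxE addn0.
rewrite exprS -mulmxE -mulmxA IH /augmx scale_block_mx mul_block_col scaler0 mul0mx.
rewrite add0r -!scalemxAl -!scalemxAr !scalerA -exprS.
rewrite mul_Bmx_shifted_ep mul_Kmx_shifted_ep; congr col_mx.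
(* the terms with j <= m come from A, the term j = m + 1 comes from B *)
rewrite [RHS](bigID (fun j : 'I_p.+1 => (j <= m)%N))/=; congr (_ + _).
  rewrite mulmx_sumr scaler_sumr; apply: eq_big => [j|j jm]; first by lia.
  rewrite subSn// exprS -mulmxE -mulmxA -!scalemxAl -!scalemxAr !scalerA.
  by rewrite mulrC.
rewrite scaler_sumr; apply: eq_big => [j|j /eqP ->]; first by lia.
by rewrite subnn expr0 mul1mx.
Qed.

(** * The exponential of the augmented matrix *)

Lemma sum_shifted_series (R : realType) (n j k : nat) (M : 'M[R]_n) :
  \sum_(0 <= m < k | (j <= m)%N) (m`!%:R)^-1 *: M ^+ (m - j) =
  series (fun m => ((m + j)`!%:R)^-1 *: M ^+ m) (k - j)%N.
Proof.
rewrite -(big_nat_widenl _ _ _ predT)// -{1}[j]add0n big_addn /series/=.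
by apply: eq_bigr => m _; rewrite addnK.
Qed.

Theorem theorem1 (R : realType) (N p : nat) (hN : (1 <= N)%N) (hp : (1 <= p)%N)
    (A : 'M[R]_N) (b : 'I_p.+1 -> 'cV[R]_N) (tau : R) :
  let v : 'cV[R]_(N + p) := col_mx (b ord0) (ep R p) in
  let w : 'cV[R]_(N + p) := expmx (tau *: augmx A b) *m v in
  usubmx w = \sum_(j < p.+1) tau ^+ j *: (phimx j (tau *: A) *m b j)
  /\ dsubmx w = \col_(i < p) (tau ^+ (p - i.+1) / (p - i.+1)`!%:R).
Proof.
move=> v w.
pose S k := series (fun m => (m`!%:R)^-1 *: (tau *: augmx A b) ^+ m) k *m v.
have Sw : S @ \oo --> w by apply: cvg_mulmxr; exact: expmx_cvg.
have SE k : S k = \sum_(0 <= m < k) (m`!%:R)^-1 *: col_mx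
    (\sum_(j < p.+1 | (j <= m)%N) tau ^+ j *: ((tau *: A) ^+ (m - j) *m b j))
    (tau ^+ m *: \col_(i < p) (i.+1 + m == p)%N%:R).
  rewrite /S /series/= mulmx_suml; apply: eq_bigr => m _.
  by rewrite -scalemxAl exprmx_augmx_mul.
have top k : usubmx (S k) = \sum_(j < p.+1) tau ^+ j *:
    (series (fun m => ((m + j)`!%:R)^-1 *: (tau *: A) ^+ m) (k - j)%N *m b j).
  rewrite SE linear_sum/=.
  under eq_bigr do rewrite linearZ/= col_mxKu scaler_sumr.
  (* collect the contributions of each b_j over all the powers m >= j *)
  rewrite (exchange_big_dep predT)//=; apply: eq_bigr => j _.
  rewrite -sum_shifted_series mulmx_suml scaler_sumr; apply: eq_bigr => m _.
  by rewrite -scalemxAl !scalerA mulrC.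
have bot k i l : (p <= k)%N ->
    dsubmx (S k) i l = tau ^+ (p - i.+1) / (p - i.+1)`!%:R.
  move=> pk; rewrite SE linear_sum summxE big_mkord/=.
  (* only the power m = p - (i + 1) has a nonzero entry in row i *)
  have ik : (p - i.+1 < k)%N by have := ltn_ord i; lia.
  rewrite (bigD1 (Ordinal ik))//= linearZ/= col_mxKd !mxE.
  rewrite subnKC ?eqxx ?mulr1; last exact: ltn_ord.
  rewrite big1 => [|m mP]; first by rewrite addr0 mulrC.
  rewrite linearZ/= col_mxKd !mxE (_ : _ == _ = false) ?mulr0//.
  by apply/negbTE; apply: contra mP => /eqP im; rewrite -val_eqE /=; lia.
split.
  have utop : usubmx (S k) @[k --> \oo] --> usubmx w.
    apply: cvg_entries => i j; rewrite mxE.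
    by under eq_cvg do rewrite mxE; exact: cvg_coord.
  apply: (cvg_unique (@norm_hausdorff _ _) utop).
  rewrite (funext top : (fun k => usubmx (S k)) = _).
  apply: cvg_sumr => j _; apply: cvgZr; apply: cvg_mulmxr.
  by rewrite cvg_centern; exact: phimx_cvg.
apply/matrixP => i l; rewrite [RHS]mxE.
have dbot : dsubmx (S k) i l @[k --> \oo] --> dsubmx w i l.
  by rewrite mxE; under eq_cvg do rewrite mxE; exact: cvg_coord.
apply: (cvg_unique _ dbot) => //; apply: cvg_near_cst.
by exists p => // k pk; exact: bot.
Qed.
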